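(* Let $D=\beta^2+4\alpha^2$, where $\alpha,\beta\in\mathbb{N}$ are coprime and $D$ is not a square. Then the negative Pell's equation $x^2-Dy^2=-4$ has integer solutions if and only if the integral binary quadratic form $\alpha x^2+\beta xy-\alpha y^2$ is $\mathrm{GL}_2(\mathbb{Z})$-equivalent to a form of the shape $ax^2+bxy+cy^2$ (with $a,b,c\in\mathbb{Z}$) with $a$ dividing $b$.
   Context: $\mathbb{N}$ denotes the positive integers. $\mathrm{GL}_2(\mathbb{Z})$-equivalence of binary quadratic forms is with respect to $f_T(x,y)=\det(T)^{-1}f(t_1x+t_2y,t_3x+t_4y)$ for $T=\begin{pmatrix} t_1&t_2\\t_3&t_4\end{pmatrix}\in\mathrm{GL}_2(\mathbb{Z})$. *)

(* Defs.v *)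
From mathcomp Require Import all_boot all_order all_algebra.

Set Implicit Arguments.
Unset Strict Implicit.
Unset Printing Implicit Defensive.

Import Order.TTheory GRing.Theory Num.Theory.
Local Open Scope ring_scope.

(* An integral binary form is identified with the function it induces on
   int * int, which determines its coefficients. *)
Definition bqf (a b c x y : int) : int :=
  a * x ^+ 2 + b * x * y + c * y ^+ 2.

(* The substitution action is twisted by det(T)^-1. The inverse is taken in the
   unit ring int, so it is meaningful only when \det T = 1 or \det T = -1. *)
Definition form_subst (f : int -> int -> int) (T : 'M[int]_2) (x y : int) : int :=
  (\det T)^-1 * f (T 0 0 * x + T 0 1 * y) (T 1 0 * x + T 1 1 * y).

(* T \in unitmx says that T is in GL_2(Z). *)
Definition GL2Z_equiv (f g : int -> int -> int) : Prop :=
  exists2 T : 'M[int]_2, T \in unitmx & forall x y, g x y = form_subst f T x y.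

(* Main.v *)
(** Write [J] for the rotation [(x, y) |-> (y, -x)], so that [f o J = - f], and
    [f o M = - f] with [\det M = -1] for the matrix [M] of multiplication by a
    unit [(x + y sqrt D) / 2] of norm -1. Then [S = J M] is an integral
    involution of determinant -1 with [f o S = f]; completing a primitive
    eigenvector of [S] for -1 to a basis of [Z^2] turns [S] into
    [(x, y) |-> (- x - k y, y)], whose invariant forms are exactly those with
    [b = k a]. Conversely, composing that symmetry of [a x^2 + b x y + c y^2]
    with the conjugate of [J] gives an automorph of determinant -1 changing the
    sign of the form; its trace and its lower left entry divided by [a] solve
    the negative Pell equation. *)
Require Import Defs.
From mathcomp Require Import all_boot all_order all_algebra.
From mathcomp Require Import zify ring.

Set Implicit Arguments.
Unset Strict Implicit.
Unset Printing Implicit Defensive.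

Import Order.TTheory GRing.Theory Num.Theory.
Local Open Scope ring_scope.

Lemma det_mx22 (R : comNzRingType) (A : 'M[R]_2) :
  \det A = A 0 0 * A 1 1 - A 0 1 * A 1 0.
Proof.
rewrite (expand_det_row _ 0) !big_ord_recl big_ord0 /cofactor !det_mx11 !mxE /=.
rewrite addr0 expr0 mul1r expr1 mulN1r mulrN.
by congr (A _ _ * A _ _ - A _ _ * A _ _); apply: val_inj.
Qed.

(** Used to complete the primitive vector along an eigenvector to a basis. *)
Lemma bezout_primitive (m n : int) : n != 0 ->
  exists p q r s g : int,
    [/\ g != 0, m = p * g, n = r * g & p * s - q * r = 1].
Proof.
move=> n_neq0; have [u [v uvE]] := Bezoutz m n.
have /dvdzP[p mE] := dvdz_gcdl m n; have /dvdzP[r nE] := dvdz_gcdr m n.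
have g_neq0 : gcdz m n != 0 by rewrite gcdz_eq0 negb_and n_neq0 orbT.
exists p, (- v), r, u, (gcdz m n); split=> //.
apply: (mulIf g_neq0); rewrite mul1r.
transitivity (u * (p * gcdz m n) + v * (r * gcdz m n)); first by ring.
by rewrite -mE -nE.
Qed.

Lemma bqf_substE (a b c p q r s x y : int) :
  bqf a b c (p * x + q * y) (r * x + s * y) =
  bqf (bqf a b c p r)
      (2 * a * p * q + b * (p * s + q * r) + 2 * c * r * s)
      (bqf a b c q s) x y.
Proof. by rewrite /bqf; ring. Qed.

Lemma mul_bqf (k a b c x y : int) :
  k * bqf a b c x y = bqf (k * a) (k * b) (k * c) x y.
Proof. by rewrite /bqf; ring. Qed.

Lemma bqf_inj (a b c a' b' c' : int) :
  bqf a b c =2 bqf a' b' c' -> [/\ a = a', b = b' & c = c'].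
Proof.
by move=> e; move: (e 1 0) (e 0 1) (e 1 1); rewrite /bqf => *; split; lia.
Qed.

(** As [d] is 1 or -1, the twist [d^-1] is [d] itself. *)
Lemma GL2Z_equiv_bqfP (a b c a' b' c' : int) :
  GL2Z_equiv (bqf a b c) (bqf a' b' c') <->
  exists p q r s d : int,
    [/\ d = p * s - q * r, d ^+ 2 = 1, a' = d * bqf a b c p r,
        b' = d * (2 * a * p * q + b * (p * s + q * r) + 2 * c * r * s)
      & c' = d * bqf a b c q s].
Proof.
split=> [[T uT gE]|[p [q [r [s [d [dE d2 aE bE cE]]]]]]].
  exists (T 0 0), (T 0 1), (T 1 0), (T 1 1), (\det T).
  have [-> -> ->] := bqf_inj (fun x y =>
    etrans (gE x y) (etrans (congr1 _ (bqf_substE _ _ _ _ _ _ _ _ _))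
                            (mul_bqf _ _ _ _ _ _))).
  split=> //; first exact: det_mx22.
  by move: uT; rewrite unitmxE => /orP[] /eqP->.
pose T : 'M[int]_2 := \matrix_(i, j)
  if i == 0 then (if j == 0 then p else q) else (if j == 0 then r else s).
have detT : \det T = d by rewrite det_mx22 !mxE dE.
exists T => [|x y].
  by rewrite unitmxE detT; move/eqP: d2; rewrite sqrf_eq1.
by rewrite /form_subst detT !mxE /= bqf_substE mul_bqf -aE -bE -cE.
Qed.

Lemma neg_pell_of_dvd (al be p q r s d a b c k : int) :
  coprimez al be ->
  d = p * s - q * r -> d ^+ 2 = 1 ->
  a = d * bqf al be (- al) p r ->
  b = d * (2 * al * p * q + be * (p * s + q * r) + 2 * (- al) * r * s) ->
  c = d * bqf al be (- al) q s ->
  b = k * a ->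
  exists x y : int, x ^+ 2 - (be ^+ 2 + 4 * al ^+ 2) * y ^+ 2 = - 4.
Proof.
rewrite /bqf => co_albe dE d2 aE bE cE bka.
set A := p ^+ 2 + r ^+ 2; set B := p * q + r * s; set C := q ^+ 2 + s ^+ 2.
(* The forms (al, be, - al) and (1, 0, 1) are apolar, and apolarity survives
   the common substitution that turns them into (a, b, c) and (A, 2 B, C). *)
have apolar : a * C - b * B + c * A = 0 by rewrite aE bE cE /A /B /C; ring.
(* Undoing the substitution shows that [a], [b], [c] have no common factor; as [a] divides [b],
   already [a] and [c] are coprime. *)
have alE : al = d * (a * s ^+ 2 - b * r * s + c * r ^+ 2).
  transitivity (d ^+ 2 * d ^+ 2 * al); first by rewrite d2; ring.
  by rewrite aE bE cE dE; ring.
have beE : be = d * bqf a b c (s - q) (p - r).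
  transitivity (d ^+ 2 * d ^+ 2 * be); first by rewrite d2; ring.
  by rewrite /bqf aE bE cE dE; ring.
have co_ac : coprimez a c.
  have ga : (gcdz a c %| a)%Z by apply: dvdz_gcdl.
  have gc : (gcdz a c %| c)%Z by apply: dvdz_gcdr.
  have gb : (gcdz a c %| b)%Z by rewrite bka dvdz_mull.
  have : (gcdz a c %| gcdz al be)%Z.
    rewrite dvdz_gcd alE beE /bqf.
    by rewrite !(dvdz_mull d) // !(rpredB, rpredD) // ?dvdz_mulr.
  by rewrite (eqP co_albe) dvdz1.
have aA : (a %| A)%Z.
  rewrite -(Gauss_dvdzr _ co_ac); apply/dvdzP; exists (k * B - C).
  by apply/eqP; rewrite -subr_eq0 -apolar bka; apply/eqP; ring.
have /dvdzP[y Ay] := aA.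
have AC : A * C - B ^+ 2 = 1 by rewrite -d2 dE /A /B /C; ring.
(* Up to sign, [b A - 2 a B] and [2 a] are the real and imaginary parts of
   [(be + 2 al i) (p + r i)^2]; take norms. *)
have key : (b * A - 2 * a * B) ^+ 2 + 4 * a ^+ 2
           = (be ^+ 2 + 4 * al ^+ 2) * A ^+ 2.
  have -> : b * A - 2 * a * B
            = d ^+ 2 * (be * (p ^+ 2 - r ^+ 2) - 4 * al * p * r).
    by rewrite aE bE dE /A /B; ring.
  by rewrite d2 mul1r aE exprMn d2 /A; ring.
have a_neq0 : a != 0.
  apply/eqP => a0; move: AC (sqr_ge0 B); rewrite Ay a0 mulr0 mul0r sub0r.
  by move/eqP; rewrite eqr_oppLR => /eqP->.
exists (k * A - 2 * B), y.
apply: (mulfI (expf_neq0 2 a_neq0)).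
transitivity ((b * A - 2 * a * B) ^+ 2 - (be ^+ 2 + 4 * al ^+ 2) * A ^+ 2).
  by rewrite Ay bka; ring.
by rewrite -key; ring.
Qed.

Lemma dvd_of_neg_pell (al be x y : int) :
  0 < al -> 0 < y -> x ^+ 2 - (be ^+ 2 + 4 * al ^+ 2) * y ^+ 2 = - 4 ->
  exists p q r s : int, p * s - q * r = 1 /\
    (bqf al be (- al) p r %|
      2 * al * p * q + be * (p * s + q * r) + 2 * (- al) * r * s)%Z.
Proof.
move=> al_gt0 y_gt0 pell.
(* Modulo 2 the Pell equation says that [x] and [be y] have equal parity. *)
have [Q xE] : exists Q, x = 2 * Q - be * y.
  have : (2 %| (x + be * y) ^+ 2)%Z.
    apply/dvdzP.
    exists (be ^+ 2 * y ^+ 2 + 2 * al ^+ 2 * y ^+ 2 - 2 + x * be * y).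
    by lia.
  rewrite dvdzE abszX Euclid_dvdX // -dvdzE andbT => /dvdzP[Q e].
  by exists Q; lia.
set P := al * y; set R := be * y - Q.
have detS : P ^+ 2 + Q * R = 1.
  apply: (@mulfI _ (- 4)) => //; rewrite mulr1 -[RHS]pell xE /P /R; ring.
have P1_neq0 : P + 1 != 0.
  by rewrite gt_eqF // addr_gt0 // mulr_gt0.
(* [(- Q, P + 1)] is an eigenvector of [(P, Q; R, - P)] for -1. *)
have [p [q [r [s [g [g_neq0 QE PE det1]]]]]] := bezout_primitive (- Q) P1_neq0.
have Sp : P * p + Q * r = - p.
  apply: (mulIf g_neq0); transitivity (P * (p * g) + Q * (r * g)); first by ring.
  by rewrite mulNr -PE -QE; ring.
have Sr : R * p - P * r = - r.
  apply: (mulIf g_neq0); transitivity (R * (p * g) - P * (r * g)); first by ring.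
  rewrite mulNr -PE -QE; transitivity (- P - (P ^+ 2 + Q * R)); first by ring.
  by rewrite detS; ring.
exists p, q, r, s; split=> //; apply/dvdzP.
(* By Cramer's rule, [l] is the [(p, r)]-coordinate of [S (q, s)]; the other coordinate is 1 because
   [S] has trace 0. *)
pose l := 2 * P * q * s + Q * s ^+ 2 - R * q ^+ 2.
have mu1 : p * (R * q - P * s) - r * (P * q + Q * s) = 1.
  transitivity (q * (R * p - P * r) - s * (P * p + Q * r)); first by ring.
  by rewrite Sp Sr -det1; ring.
have Sq : P * q + Q * s = l * p + q.
  transitivity ((p * s - q * r) * (P * q + Q * s)); first by rewrite det1 mul1r.
  by rewrite -[in RHS](mulr1 q) -mu1 /l; ring.
have Ss : R * q - P * s = l * r + s.
  transitivity ((p * s - q * r) * (R * q - P * s)); first by rewrite det1 mul1r.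
  by rewrite -[in RHS](mulr1 s) -mu1 /l; ring.
pose B v w v' w' : int :=
  2 * al * v * v' + be * (v * w' + w * v') - 2 * al * w * w'.
(* The involution [S = (P, Q; R, - P)] is self-adjoint for the polar form. *)
have : B (P * p + Q * r) (R * p - P * r) q s
       = B p r (P * q + Q * s) (R * q - P * s).
  by rewrite /B /P /R; ring.
rewrite Sp Sr Sq Ss => SB.
(* With [v = (p, r)] and [w = (q, s)], [SB] reads [- B(v, w) = l B(v, v) + B(v, w)], where [B(v, v)]
   is twice the value of the form at [v]. *)
exists (- l); apply: (@mulfI _ 2) => //.
transitivity (B p r q s - B (- p) (- r) q s); first by rewrite /B; ring.
by rewrite SB /B /bqf; ring.
Qed.

Theorem theorem1p4 (alpha beta D : nat)
    (alpha_gt0 : (0 < alpha)%N) (beta_gt0 : (0 < beta)%N)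
    (co_alpha_beta : coprime alpha beta)
    (defD : D = (beta ^ 2 + 4 * alpha ^ 2)%N)
    (D_nonsquare : ~ exists m : nat, D = (m ^ 2)%N) :
  (exists x y : int, x ^+ 2 - D%:Z * y ^+ 2 = - 4%:Z)
  <->
  (exists a b c : int,
     (a %| b)%Z /\
     GL2Z_equiv (bqf alpha%:Z beta%:Z (- alpha%:Z)) (bqf a b c)).
Proof.
have -> : D%:Z = beta%:Z ^+ 2 + 4 * alpha%:Z ^+ 2 by rewrite defD; lia.
split=> [[x [y pell]]|[a [b [c [/dvdzP[k bka] /GL2Z_equiv_bqfP]]]]].
  (* Only [y^2] matters, and [y = 0] would give [x^2 = -4]. *)
  have [|||p [q [r [s [det1 a_dvd_b]]]]] :=
    @dvd_of_neg_pell alpha beta x `|y|%:Z.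
  - by [].
  - by case: (eqVneq y 0) pell => [->|]; nia.
  - by rewrite abszE real_normK ?num_real.
  eexists _, _, _; split; first exact: a_dvd_b.
  apply/GL2Z_equiv_bqfP; exists p, q, r, s, 1.
  by rewrite !mul1r det1.
case=> p [q [r [s [d [dE d2 aE bE cE]]]]].
exact: (neg_pell_of_dvd _ dE d2 aE bE cE bka).
Qed.
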